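(* Let $v(\cdot)$ denote the optimal value of a minimization problem (the infimum, with value $+\infty$ if the problem is infeasible). Assume $c_i\in\mathrm{Range}(Q_i)$ for every $i\in\mathcal{N}$. For the problem (P) and its relaxations $(\mathrm{SDP})$, $(\mathrm{SDP_{RLT}})$, $(\mathrm{SDP_{SOC\text{-}RLT}})$, $(\mathrm{SDP_{GSRT\text{-}B}})$ defined in the context, $$v(\mathrm{P})\ \ge\ v(\mathrm{SDP_{GSRT\text{-}B}})\ \ge\ v(\mathrm{SDP_{SOC\text{-}RLT}})\ \ge\ v(\mathrm{SDP_{RLT}})\ \ge\ v(\mathrm{SDP}).$$
   Context: Data: $Q_0,\dots,Q_l$ real symmetric $n\times n$ matrices ($Q_i\ne 0$ for $i\ge 1$), $c_0,\dots,c_l\in\mathbb{R}^n$, $d_1,\dots,d_l\in\mathbb{R}$, $a_1,\dots,a_m\in\mathbb{R}^n$, $b_1,\dots,b_m\in\mathbb{R}$. Problem (P): minimize $x^TQ_0x+c_0^Tx$ over $x\in\mathbb{R}^n$ subject to $x^TQ_ix+c_i^Tx+d_i\le 0$ ($i=1,\dots,l$) and $a_j^Tx\le b_j$ ($j=1,\dots,m$). Let $\mathcal{C}=\{i\in\{1,\dots,l\}: Q_i\succeq 0\}$ and $\mathcal{N}=\{1,\dots,l\}\setminus\mathcal{C}$. For $i\in\mathcal{C}$ fix a matrix $B_i\in\mathbb{R}^{n\times n}$ with $Q_i=B_i^TB_i$. For $i\in\mathcal{N}$ write $Q_i=L_i^TL_i-M_i^TM_i$, where, from a spectral decomposition of $Q_i$,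 the rows of $L_i$ are $\sqrt{\lambda}\,v^T$ over the positive eigenvalues $\lambda$ (with orthonormal eigenvectors $v$) and the rows of $M_i$ are $\sqrt{-\lambda}\,v^T$ over the negative eigenvalues. $A\cdot B=\sum_{i,j}A_{ij}B_{ij}$, $\|\cdot\|$ is the Euclidean norm, and $Q^{\dagger}$ is the Moore-Penrose pseudoinverse. The relaxations have a variable $x\in\mathbb{R}^n$ and a symmetric $n\times n$ matrix variable $X$, and objective: minimize $Q_0\cdot X+c_0^Tx$. $(\mathrm{SDP})$ has the constraints: (1) $Q_i\cdot X+c_i^Tx+d_i\le0$, $i=1,\dots,l$; (2) $a_j^Tx\le b_j$, $j=1,\dots,m$; (3) $\begin{pmatrix}1&x^T\\ x&X\end{pmatrix}\succeq0$. $(\mathrm{SDP_{RLT}})$ has the constraints (1), (2), (3) and: (4) $a_ia_j^T\cdot X+b_ib_j-b_ja_i^Tx-b_ia_j^Tx\ge0$ for all $1\le i<j\le m$. $(\mathrm{SDP_{SOC\text{-}RLT}})$ has the constraints (1)-(4) and: (5) for all $i\in\mathcal{C}$, $j=1,\dots,m$, $$\left\|\begin{pmatrix}B_i(b_jx-Xa_j)\\ \tfrac12\left(-c_i^TXa_j+(b_jc_i^T-d_ia_j^T-a_j^T)x+(1+d_i)b_j\right)\end{pmatrix}\right\|\le\tfrac12\left(c_i^TXa_j+(d_ia_j^T-a_j^T-b_jc_i^T)x+(1-d_i)b_j\right).$$ $(\mathrm{SDP_{GSRT\text{-}B}})$ has additional variables $z\in\mathbb{R}^{\mathcal{N}}$,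 $S\in\mathbb{R}^{n\times\mathcal{N}}$ and a symmetric $Z\in\mathbb{R}^{\mathcal{N}\times\mathcal{N}}$ ($S_{\cdot,i}$ is the column of $S$ indexed by $i$), and the constraints (1), (2), (4), (5), the constraint $\begin{pmatrix}1&x^T&z^T\\ x&X&S\\ z&S^T&Z\end{pmatrix}\succeq0$, and, for each $i\in\mathcal{N}$, the following GSRT-B constraints, where $p_i=\tfrac12Q_i^{\dagger}c_i$ and $w_{ij}=b_jx-Xa_j+p_i(b_j-a_j^Tx)$: (i) if $\tfrac14c_i^TQ_i^{\dagger}c_i-d_i>0$, put $\Delta_i=\sqrt{\tfrac14c_i^TQ_i^{\dagger}c_i-d_i}$ and require $$\|L_i(x+p_i)\|\le z_i,\quad \left\|\begin{pmatrix}M_i(x+p_i)\\ \Delta_i\end{pmatrix}\right\|\le z_i,\quad Z_{i,i}=M_i^TM_i\cdot\left(X+\tfrac14Q_i^{\dagger}c_ic_i^TQ_i^{\dagger}+Q_i^{\dagger}c_ix^T\right)+\Delta_i^2,$$ and for $j=1,\dots,m$: $\ \|L_iw_{ij}\|\le z_ib_j-a_j^TS_{\cdot,i}$, $\ \left\|\begin{pmatrix}M_iw_{ij}\\ \Delta_i(b_j-a_j^Tx)\end{pmatrix}\right\|\le z_ib_j-a_j^TS_{\cdot,i}$; (ii) if $\tfrac14c_i^TQ_i^{\dagger}c_i-d_i\le0$, put $\Delta_i=\sqrt{d_i-\tfrac14c_i^TQ_i^{\dagger}c_i}$ and require $$\left\|\begin{pmatrix}L_i(x+p_i)\\ \Delta_i\end{pmatrix}\right\|\le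 z_i,\quad \|M_i(x+p_i)\|\le z_i,\quad Z_{i,i}=M_i^TM_i\cdot\left(X+\tfrac14Q_i^{\dagger}c_ic_i^TQ_i^{\dagger}+Q_i^{\dagger}c_ix^T\right),$$ and for $j=1,\dots,m$: $\ \left\|\begin{pmatrix}L_iw_{ij}\\ \Delta_i(b_j-a_j^Tx)\end{pmatrix}\right\|\le z_ib_j-a_j^TS_{\cdot,i}$, $\ \|M_iw_{ij}\|\le z_ib_j-a_j^TS_{\cdot,i}$. *)

(* Defs.v *)
From HB Require Import structures.
From mathcomp Require Import all_boot all_order all_algebra.
From mathcomp Require Import boolp classical_sets reals constructive_ereal ereal.

Set Implicit Arguments.
Unset Strict Implicit.
Unset Printing Implicit Defensive.

Import Order.TTheory GRing.Theory Num.Theory.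
Local Open Scope classical_set_scope.
Local Open Scope ring_scope.

Definition dotp (R : realType) n (u v : 'cV[R]_n) : R := \sum_(i < n) u i 0 * v i 0.

Definition mxdotp (R : realType) n (A B : 'M[R]_n) : R :=
  \sum_(i < n) \sum_(j < n) A i j * B i j.

(* The norm [`|v|] provided by MathComp-Analysis on matrices is the sup norm. *)
Definition enorm (R : realType) n (v : 'cV[R]_n) : R := Num.sqrt (dotp v v).

Definition psd (R : realType) n (A : 'M[R]_n) : Prop :=
  A^T = A /\ forall v : 'cV[R]_n, 0 <= dotp v (A *m v).

Definition is_pseudoinverse (R : realType) m n (A : 'M[R]_(m, n)) (P : 'M[R]_(n, m)) : Prop :=
  [/\ A *m P *m A = A, P *m A *m P = P,
      (A *m P)^T = A *m P & (P *m A)^T = P *m A].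

(* [xget] picks an element of the set, here the only one: see
   [pseudoinverseP] and [is_pseudoinverse_inj]. *)
Definition pseudoinverse (R : realType) m n (A : 'M[R]_(m, n)) : 'M[R]_(n, m) :=
  xget 0 [set P | is_pseudoinverse A P].

Lemma is_pseudoinverse_inj (R : realType) m n (A : 'M[R]_(m, n)) (P P' : 'M[R]_(n, m)) :
  is_pseudoinverse A P -> is_pseudoinverse A P' -> P = P'.
Proof.
move=> [APA PAP sAP sPA] [APA' PAP' sAP' sPA'].
have AP : A *m P = A *m P'.
  rewrite -{1}APA' -mulmxA -sAP' -sAP -trmx_mul.
  by rewrite mulmxA APA sAP'.
have PA : P *m A = P' *m A.
  rewrite -{1}APA' !mulmxA -mulmxA -sPA -sPA' -trmx_mul.
  by rewrite -mulmxA [A *m _]mulmxA APA sPA'.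
by rewrite -PAP PA -mulmxA AP mulmxA PAP'.
Qed.

Lemma gram_unit (R : realType) r n (A : 'M[R]_(r, n)) :
  row_free A -> A *m A^T \in unitmx.
Proof.
move=> fA; rewrite -row_free_unit -kermx_eq0.
apply/eqP/row_matrixP => i; rewrite row0.
have := mulmx_ker (A *m A^T); move/(congr1 (row i)).
rewrite row_mul row0; set u := row i _ => uAA.
have : (u *m A) *m (u *m A)^T = 0.
  by rewrite trmx_mul mulmxA -[u *m A *m A^T]mulmxA uAA mul0mx.
move=> /matrixP/(_ 0 0); rewrite !mxE => /eqP.
under eq_bigr do rewrite [X in _ * X]mxE.
rewrite psumr_eq0 => [/allP h|j _]; last by rewrite -expr2 sqr_ge0.
have : u *m A = 0.
  apply/matrixP => a j; rewrite ord1 [RHS]mxE.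
  by have := h j (mem_index_enum _); rewrite mulf_eq0 orbb => /eqP.
by move/eqP; rewrite mulmx_free_eq0 // => /eqP.
Qed.

Lemma is_pseudoinverse_mul (R : realType) m n r (C : 'M[R]_(m, r)) (F : 'M[R]_(r, n)) :
  C^T *m C \in unitmx -> F *m F^T \in unitmx ->
  is_pseudoinverse (C *m F) (F^T *m invmx (F *m F^T) *m invmx (C^T *m C) *m C^T).
Proof.
move=> uC uF; set G := invmx (F *m F^T); set H := invmx (C^T *m C).
have sG : G^T = G by rewrite /G trmx_inv trmx_mul trmxK.
have sH : H^T = H by rewrite /H trmx_inv trmx_mul trmxK.
have AP : C *m F *m (F^T *m G *m H *m C^T) = C *m H *m C^T.
  rewrite !mulmxA -[C *m F *m F^T]mulmxA -[C *m _ *m G]mulmxA.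
  by rewrite mulmxV // mulmx1.
have PA : F^T *m G *m H *m C^T *m (C *m F) = F^T *m G *m F.
  rewrite !mulmxA -[_ *m C^T *m C]mulmxA -[_ *m H *m _]mulmxA.
  by rewrite mulVmx // mulmx1.
split.
- rewrite AP !mulmxA -[_ *m C^T *m C]mulmxA -[_ *m H *m _]mulmxA.
  by rewrite mulVmx // mulmx1.
- rewrite PA !mulmxA -[_ *m F *m F^T]mulmxA -[_ *m G *m (F *m _)]mulmxA.
  by rewrite mulVmx // mulmx1.
- by rewrite AP !trmx_mul trmxK sH mulmxA.
- by rewrite PA !trmx_mul trmxK sG mulmxA.
Qed.

Lemma pseudoinverseP (R : realType) m n (A : 'M[R]_(m, n)) :
  is_pseudoinverse A (pseudoinverse A).
Proof.
rewrite /pseudoinverse; apply: (@xgetPex _ 0 [set P | is_pseudoinverse A P]).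
have := @is_pseudoinverse_mul R m n _ (col_base A) (row_base A).
rewrite mulmx_base => h; eexists; apply: h; last exact/gram_unit/row_base_free.
have := @gram_unit R _ _ (col_base A)^T; rewrite trmxK; apply.
by rewrite /row_free mxrank_tr; exact: col_base_full.
Qed.

(* The rows of [V] are orthonormal eigenvectors of [Q], with eigenvalues the
   entries of [lam]. *)
Definition spectral_decomp (R : realType) n (Q V : 'M[R]_n) (lam : 'rV[R]_n) : Prop :=
  V *m V^T = 1%:M /\ Q = V^T *m diag_mx lam *m V.

(* The rows are [sqrt (lam_k)] times row [k] of [V], for the [k] such that
   [0 < lam_k]; the index [s] runs over these [k] through [enum_val]. *)
Definition pos_factor (R : realType) n (V : 'M[R]_n) (lam : 'rV[R]_n) :
    'M[R]_(#|[set k | 0 < lam 0 k]%SET|, n) :=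
  \matrix_(s, j) (Num.sqrt (lam 0 (enum_val s)) * V (enum_val s) j).

Definition neg_factor (R : realType) n (V : 'M[R]_n) (lam : 'rV[R]_n) :
    'M[R]_(#|[set k | lam 0 k < 0]%SET|, n) :=
  \matrix_(s, j) (Num.sqrt (- lam 0 (enum_val s)) * V (enum_val s) j).

Definition optval (R : realType) T (f : T -> R) (F : set T) : \bar R :=
  ereal_inf [set (f y)%:E | y in F].

Record qcqp (R : realType) (n l m : nat) := QCQP {
  qQ0 : 'M[R]_n;
  qc0 : 'cV[R]_n;
  qQ : 'I_l -> 'M[R]_n;
  qc : 'I_l -> 'cV[R]_n;
  qd : 'I_l -> R;
  qa : 'I_m -> 'cV[R]_n;
  qb : 'I_m -> R }.

Definition convex_idx (R : realType) n l m (P : qcqp R n l m) : {set 'I_l} :=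
  [set i | `[< psd (qQ P i) >]]%SET.

Definition nonconvex_idx (R : realType) n l m (P : qcqp R n l m) : {set 'I_l} :=
  (~: convex_idx P)%SET.

Definition linear_cstr (R : realType) n l m (P : qcqp R n l m) (x : 'cV[R]_n) : Prop :=
  forall j, dotp (qa P j) x <= qb P j.

Definition qp_feasible (R : realType) n l m (P : qcqp R n l m) : set 'cV[R]_n :=
  [set x | (forall i, dotp x (qQ P i *m x) + dotp (qc P i) x + qd P i <= 0) /\
           linear_cstr P x].

Definition v_P (R : realType) n l m (P : qcqp R n l m) : \bar R :=
  optval (fun x => dotp x (qQ0 P *m x) + dotp (qc0 P) x) (qp_feasible P).

Definition relaxed_obj (R : realType) n l m (P : qcqp R n l m)
    (x : 'cV[R]_n) (X : 'M[R]_n) : R :=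
  mxdotp (qQ0 P) X + dotp (qc0 P) x.

Definition lifted_quad (R : realType) n l m (P : qcqp R n l m)
    (x : 'cV[R]_n) (X : 'M[R]_n) : Prop :=
  forall i, mxdotp (qQ P i) X + dotp (qc P i) x + qd P i <= 0.

Definition lifted_psd (R : realType) n (x : 'cV[R]_n) (X : 'M[R]_n) : Prop :=
  psd (block_mx (1%:M : 'M[R]_1) x^T x X).

Definition rlt_cstr (R : realType) n l m (P : qcqp R n l m)
    (x : 'cV[R]_n) (X : 'M[R]_n) : Prop :=
  forall i j : 'I_m, (i < j)%N ->
    mxdotp (qa P i *m (qa P j)^T) X + qb P i * qb P j
      - qb P j * dotp (qa P i) x - qb P i * dotp (qa P j) x >= 0.

Definition socrlt_cstr (R : realType) n l m (P : qcqp R n l m) (B : 'I_l -> 'M[R]_n)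
    (x : 'cV[R]_n) (X : 'M[R]_n) : Prop :=
  forall i j, i \in convex_idx P ->
    let ci := qc P i in let di := qd P i in
    let aj := qa P j in let bj := qb P j in
    enorm (col_mx (B i *m (bj *: x - X *m aj))
                  ((2^-1 * (- dotp ci (X *m aj)
                            + dotp (bj *: ci - di *: aj - aj) x
                            + (1 + di) * bj))%:M : 'cV[R]_1))
      <= 2^-1 * (dotp ci (X *m aj) + dotp (di *: aj - aj - bj *: ci) x
                 + (1 - di) * bj).

Definition gsrt_psd (R : realType) n N (x : 'cV[R]_n) (X : 'M[R]_n)
    (z : 'cV[R]_N) (S : 'M[R]_(n, N)) (Z : 'M[R]_N) : Prop :=
  psd (block_mx (1%:M : 'M[R]_1) (row_mx x^T z^T)
                (col_mx x z)     (block_mx X   S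
                                           S^T Z)).

(* The constraints attached to one nonconvex quadratic inequality
   [x^T Q x + c^T x + d <= 0]. The scalars [zi], [Zii] and the vector [Si] stand
   for [z_i], [Z_{i,i}] and the column of [S] indexed by [i]. *)
Definition gsrtB_cstr (R : realType) n m r s
    (a : 'I_m -> 'cV[R]_n) (b : 'I_m -> R)
    (Q : 'M[R]_n) (c : 'cV[R]_n) (d : R) (L : 'M[R]_(r, n)) (M : 'M[R]_(s, n))
    (x : 'cV[R]_n) (X : 'M[R]_n) (zi : R) (Si : 'cV[R]_n) (Zii : R) : Prop :=
  let Qd := pseudoinverse Q in
  let p := 2^-1 *: (Qd *m c) in
  let w j := b j *: x - X *m a j + (b j - dotp (a j) x) *: p in
  let gap := 4^-1 * dotp c (Qd *m c) - d in
  let Y := X + 4^-1 *: (Qd *m c *m c^T *m Qd) + Qd *m c *m x^T in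
  if 0 < gap then
    let Delta := Num.sqrt gap in
    [/\ enorm (L *m (x + p)) <= zi,
        enorm (col_mx (M *m (x + p)) (Delta%:M : 'cV[R]_1)) <= zi,
        Zii = mxdotp (M^T *m M) Y + Delta ^+ 2 &
        forall j,
          enorm (L *m w j) <= zi * b j - dotp (a j) Si /\
          enorm (col_mx (M *m w j) ((Delta * (b j - dotp (a j) x))%:M : 'cV[R]_1))
            <= zi * b j - dotp (a j) Si]
  else
    let Delta := Num.sqrt (d - 4^-1 * dotp c (Qd *m c)) in
    [/\ enorm (col_mx (L *m (x + p)) (Delta%:M : 'cV[R]_1)) <= zi,
        enorm (M *m (x + p)) <= zi,
        Zii = mxdotp (M^T *m M) Y &
        forall j,
          enorm (col_mx (L *m w j) ((Delta * (b j - dotp (a j) x))%:M : 'cV[R]_1))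
            <= zi * b j - dotp (a j) Si /\
          enorm (M *m w j) <= zi * b j - dotp (a j) Si].

Definition sdp_feasible (R : realType) n l m (P : qcqp R n l m) :
    set ('cV[R]_n * 'M[R]_n) :=
  [set y | let '(x, X) := y in
    X^T = X /\ [/\ lifted_quad P x X, linear_cstr P x & lifted_psd x X]].

Definition rlt_feasible (R : realType) n l m (P : qcqp R n l m) :
    set ('cV[R]_n * 'M[R]_n) :=
  [set y | let '(x, X) := y in
    X^T = X /\ [/\ lifted_quad P x X, linear_cstr P x, lifted_psd x X &
                   rlt_cstr P x X]].

Definition socrlt_feasible (R : realType) n l m (P : qcqp R n l m)
    (B : 'I_l -> 'M[R]_n) : set ('cV[R]_n * 'M[R]_n) :=
  [set y | let '(x, X) := y in
    X^T = X /\ [/\ lifted_quad P x X, linear_cstr P x, lifted_psd x X,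
                   rlt_cstr P x X & socrlt_cstr P B x X]].

(* The entries of [z], the columns of [S] and the rows and columns of [Z] are
   indexed by the nonconvex indices through the bijection [enum_val]. *)
Definition gsrtB_feasible (R : realType) n l m (P : qcqp R n l m)
    (B V : 'I_l -> 'M[R]_n) (lam : 'I_l -> 'rV[R]_n) :
    set ('cV[R]_n * 'M[R]_n * 'cV[R]_#|nonconvex_idx P|
         * 'M[R]_(n, #|nonconvex_idx P|) * 'M[R]_#|nonconvex_idx P|) :=
  [set y | let '(x, X, z, Smx, Z) := y in
    [/\ X^T = X, Z^T = Z & gsrt_psd x X z Smx Z] /\
    [/\ lifted_quad P x X, linear_cstr P x, rlt_cstr P x X, socrlt_cstr P B x X &
        forall k : 'I_#|nonconvex_idx P|, let i := enum_val k in
          gsrtB_cstr (qa P) (qb P) (qQ P i) (qc P i) (qd P i)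
            (pos_factor (V i) (lam i)) (neg_factor (V i) (lam i))
            x X (z k 0) (col k Smx) (Z k k)]].
Arguments gsrtB_feasible {R n l m} P B V lam.

Definition v_SDP (R : realType) n l m (P : qcqp R n l m) : \bar R :=
  optval (fun y => relaxed_obj P y.1 y.2) (sdp_feasible P).

Definition v_RLT (R : realType) n l m (P : qcqp R n l m) : \bar R :=
  optval (fun y => relaxed_obj P y.1 y.2) (rlt_feasible P).

Definition v_SOCRLT (R : realType) n l m (P : qcqp R n l m) (B : 'I_l -> 'M[R]_n) : \bar R :=
  optval (fun y => relaxed_obj P y.1 y.2) (socrlt_feasible P B).

Definition v_GSRTB (R : realType) n l m (P : qcqp R n l m)
    (B V : 'I_l -> 'M[R]_n) (lam : 'I_l -> 'rV[R]_n) : \bar R :=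
  optval (fun y => let '(x, X, z, Smx, Z) := y in relaxed_obj P x X)
         (gsrtB_feasible P B V lam).

(* Main.v *)
Require Import Defs.
From mathcomp Require Import all_boot all_order all_algebra.
From mathcomp Require Import boolp classical_sets reals constructive_ereal ereal.
From mathcomp Require Import ring lra.
Import Order.TTheory GRing.Theory Num.Theory.
Local Open Scope ring_scope.

(** The last three inequalities only say that adding constraints, or adding
    variables and forgetting them, cannot lower an infimum ([optval_le]).  The
    one constraint that is not literally repeated is the semidefinite one: the
    matrix of (SDP) is a principal submatrix of the larger matrix of
    (SDP_GSRT-B), so it inherits semidefiniteness ([gsrt_psd_lifted]).

    For the first inequality, each feasible [x] of (P) is lifted to the rank one
    point [X = x x^T], [S = x z^T], [Z = z z^T], at which the relaxed objective
    is the objective of (P).  At such a point every product constraint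
    involving a linear inequality [j] is an inequality valid for [x], multiplied
    by the slack [b_j - a_j^T x >= 0]: the vectors under the norms and the right-hand
    sides both factor through that slack ([slack_vec], [enormZ_le]).  The
    unmultiplied inequalities are rewritings of [q(x) = x^T Q x + c^T x + d <= 0].
    - If [Q = B^T B], then with [t = c^T x + d] it reads [|B x|^2 <= -t], which
      is [|B x|^2 + ((1 + t) / 2)^2 <= ((1 - t) / 2)^2].
    - If [Q = L^T L - M^T M] and [c] lies in the range of [Q], completing the
      square with [p = Q^+ c / 2] gives
      [|L (x + p)|^2 = |M (x + p)|^2 + q(x) + gap] with
      [gap = c^T Q^+ c / 4 - d] ([complete_square]).  Moving [gap] to the side
      where it is nonnegative, the side containing [M] dominates; [z] is taken
      to be its norm, which makes the prescribed value of [Z_ii] equal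
      to [z^2] ([spectral_split], [mxdotp_gram_shift], [gsrtB_rank1]). *)

(** * Inner products and Euclidean norms *)

Section InnerProduct.
Set Implicit Arguments.
Unset Strict Implicit.
Context {R : realType}.

Lemma dotpE n (u v : 'cV[R]_n) : dotp u v = (u^T *m v) 0 0.
Proof. by rewrite /dotp mxE; apply: eq_bigr => i _; rewrite mxE. Qed.

Lemma dotpC n (u v : 'cV[R]_n) : dotp u v = dotp v u.
Proof. by apply: eq_bigr => i _; rewrite mulrC. Qed.

Lemma dotpDr n (u v w : 'cV[R]_n) : dotp u (v + w) = dotp u v + dotp u w.
Proof. by rewrite !dotpE mulmxDr mxE. Qed.

Lemma dotp0r n (u : 'cV[R]_n) : dotp u 0 = 0.
Proof. by rewrite dotpE mulmx0 mxE. Qed.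

Lemma dotpZr n k (u v : 'cV[R]_n) : dotp u (k *: v) = k * dotp u v.
Proof. by rewrite !dotpE -scalemxAr mxE. Qed.

Lemma dotpBr n (u v w : 'cV[R]_n) : dotp u (v - w) = dotp u v - dotp u w.
Proof. by rewrite -scaleN1r dotpDr dotpZr mulN1r. Qed.

Lemma dotpDl n (u v w : 'cV[R]_n) : dotp (u + v) w = dotp u w + dotp v w.
Proof. by rewrite -!(dotpC w) dotpDr. Qed.

Lemma dotpZl n k (u v : 'cV[R]_n) : dotp (k *: u) v = k * dotp u v.
Proof. by rewrite -!(dotpC v) dotpZr. Qed.

Lemma dotpBl n (u v w : 'cV[R]_n) : dotp (u - v) w = dotp u w - dotp v w.
Proof. by rewrite -!(dotpC w) dotpBr. Qed.

Lemma dotp_mulmxr m n (A : 'M[R]_(m, n)) u v :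
  dotp u (A *m v) = dotp (A^T *m u) v.
Proof. by rewrite !dotpE trmx_mul trmxK mulmxA. Qed.

Lemma dotp_ge0 n (u : 'cV[R]_n) : 0 <= dotp u u.
Proof. by apply: sumr_ge0 => i _; rewrite -expr2 sqr_ge0. Qed.

Lemma dotp_col_mx m n (u u' : 'cV[R]_m) (v v' : 'cV[R]_n) :
  dotp (col_mx u v) (col_mx u' v') = dotp u u' + dotp v v'.
Proof. by rewrite !dotpE tr_col_mx mul_row_col mxE. Qed.

Lemma dotp_scalar (k h : R) : dotp (k%:M : 'cV[R]_1) (h%:M) = k * h.
Proof. by rewrite /dotp big_ord1 !mxE eqxx !mulr1n. Qed.

Lemma dotp_gram m n (A : 'M[R]_(m, n)) u v :
  dotp u (A^T *m A *m v) = dotp (A *m u) (A *m v).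
Proof. by rewrite -mulmxA dotp_mulmxr trmxK. Qed.

Lemma outer_mul n p (u : 'cV[R]_n) (v w : 'cV[R]_p) :
  u *m v^T *m w = dotp v w *: u.
Proof. by rewrite -mulmxA [v^T *m w]mx11_scalar -dotpE mul_mx_scalar. Qed.

Lemma mxdotp_outer n (A : 'M[R]_n) u v : mxdotp A (u *m v^T) = dotp u (A *m v).
Proof.
apply: eq_bigr => i _; rewrite mxE mulr_sumr; apply: eq_bigr => j _.
by rewrite !mxE big_ord1 !mxE; ring.
Qed.

Lemma mxdotpDr n (A X Y : 'M[R]_n) : mxdotp A (X + Y) = mxdotp A X + mxdotp A Y.
Proof.
rewrite -big_split; apply: eq_bigr => i _; rewrite -big_split.
by apply: eq_bigr => j _; rewrite mxE mulrDr.
Qed.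

Lemma sqr_enorm n (v : 'cV[R]_n) : enorm v ^+ 2 = dotp v v.
Proof. by rewrite sqr_sqrtr // dotp_ge0. Qed.

Lemma enorm_ge0 n (v : 'cV[R]_n) : 0 <= enorm v.
Proof. exact: sqrtr_ge0. Qed.

Lemma enorm_le n (v : 'cV[R]_n) t : 0 <= t -> dotp v v <= t ^+ 2 -> enorm v <= t.
Proof.
by move=> t0 h; rewrite -(ler_pXn2r (n := 2)) ?nnegrE ?enorm_ge0 // sqr_enorm.
Qed.

(** Multiplying a second-order cone inequality by a nonnegative slack [t]. *)
Lemma enormZ_le n (v : 'cV[R]_n) z t :
  0 <= t -> enorm v <= z -> enorm (t *: v) <= t * z.
Proof.
move=> t0 h; have z0 := le_trans (enorm_ge0 v) h.
apply: enorm_le; first exact: mulr_ge0.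
rewrite dotpZl dotpZr mulrA -expr2 exprMn ler_wpM2l ?sqr_ge0 //.
by rewrite -sqr_enorm ler_pXn2r ?nnegrE ?enorm_ge0.
Qed.

Lemma psd_outer n (v : 'cV[R]_n) : psd (v *m v^T).
Proof.
split=> [|u]; first by rewrite trmx_mul trmxK.
by rewrite outer_mul dotpZr dotpC -expr2 sqr_ge0.
Qed.

End InnerProduct.

(** * Completing the square *)

Section CompleteSquare.
Set Implicit Arguments.
Unset Strict Implicit.
Context {R : realType}.

Lemma pseudoinverse_sym n (Q : 'M[R]_n) :
  Q^T = Q -> (pseudoinverse Q)^T = pseudoinverse Q.
Proof.
move=> sQ; apply: (@is_pseudoinverse_inj _ _ _ Q); last exact: pseudoinverseP.
have [QPQ PQP sQP sPQ] := pseudoinverseP Q.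
split.
- by rewrite -[in RHS]sQ -[in RHS]QPQ !trmx_mul sQ mulmxA.
- by rewrite -[in RHS]PQP !trmx_mul sQ mulmxA.
- by rewrite trmx_mul trmxK sQ -[LHS]sPQ trmx_mul sQ.
- by rewrite trmx_mul trmxK sQ -[LHS]sQP trmx_mul sQ.
Qed.

Lemma pseudoinverse_range n (Q : 'M[R]_n) (c y : 'cV[R]_n) :
  c = Q *m y -> Q *m (pseudoinverse Q *m c) = c.
Proof. by have [QPQ _ _ _] := pseudoinverseP Q => ->; rewrite !mulmxA QPQ. Qed.

(** The quadratic has [- p] as a critical point because [2 Q p = Q (Q^+ c) = c],
    which holds exactly when [c] lies in the range of [Q]. *)
Lemma complete_square n (Q : 'M[R]_n) (c y x : 'cV[R]_n) :
  Q^T = Q -> c = Q *m y ->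
  let p := 2^-1 *: (pseudoinverse Q *m c) in
  dotp (x + p) (Q *m (x + p)) =
    dotp x (Q *m x) + dotp c x + 4^-1 * dotp c (pseudoinverse Q *m c).
Proof.
move=> sQ hc p; have Qp := pseudoinverse_range hc.
rewrite mulmxDr !dotpDl !dotpDr /p -scalemxAr Qp !dotpZl !dotpZr.
rewrite [dotp (_ *m c) (Q *m x)]dotp_mulmxr sQ Qp.
by rewrite [dotp x c]dotpC [dotp _ c]dotpC; field.
Qed.

(** Each nonzero eigenvalue contributes to exactly one of the two Gram matrices,
    according to its sign, and the zero ones contribute to neither. *)
Lemma spectral_split n (Q V : 'M[R]_n) lam : spectral_decomp Q V lam ->
  Q = (pos_factor V lam)^T *m pos_factor V lam
      - (neg_factor V lam)^T *m neg_factor V lam.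
Proof.
move=> [_ ->]; apply/matrixP => i j; rewrite !mxE.
under eq_bigr do rewrite mul_mx_diag !mxE.
under [X in X - _]eq_bigr do rewrite !mxE.
under [X in _ - X]eq_bigr do rewrite !mxE.
rewrite -(big_enum_val (fun k => Num.sqrt (lam 0 k) * V k i *
  (Num.sqrt (lam 0 k) * V k j))).
rewrite -(big_enum_val (fun k => Num.sqrt (- lam 0 k) * V k i *
  (Num.sqrt (- lam 0 k) * V k j))) /=.
rewrite [X in X - _]big_mkcond [X in _ - X]big_mkcond -sumrB.
apply: eq_bigr => k _; rewrite !inE.
have rearr a b e : a * b * (a * e) = a ^+ 2 * b * e :> R by ring.
rewrite !rearr; case: ltgtP => h.
- by rewrite sqr_sqrtr ?ltW // subr0; ring.
- by rewrite sqr_sqrtr ?oppr_ge0 ?ltW // sub0r; ring.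
- by rewrite -h; ring.
Qed.

End CompleteSquare.

(** * Constraints at a rank one point *)

Section RankOne.
Set Implicit Arguments.
Unset Strict Implicit.
Context {R : realType}.

Lemma slack_vec n (a x p : 'cV[R]_n) b :
  b *: x - x *m x^T *m a + (b - dotp a x) *: p = (b - dotp a x) *: (x + p).
Proof. by rewrite outer_mul -scalerBl dotpC scalerDr. Qed.

Lemma col_mx_slack r n (A : 'M[R]_(r, n)) (y : 'cV[R]_n) t e :
  col_mx (A *m (t *: y)) ((e * t)%:M : 'cV[R]_1) = t *: col_mx (A *m y) e%:M.
Proof. by rewrite -scalemxAr scale_col_mx scale_scalar_mx mulrC. Qed.

(** The linear form prescribing [Z_ii] carries the cross term [2 p x^T] in place
    of the symmetric [p x^T + x p^T]; pairing with a symmetric matrix does not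
    distinguish the two. *)
Lemma mxdotp_gram_shift s n (M : 'M[R]_(s, n)) (x p : 'cV[R]_n) :
  mxdotp (M^T *m M) (x *m x^T + 4^-1 *: ((2 *: p) *m (2 *: p)^T)
                     + (2 *: p) *m x^T) =
  dotp (M *m (x + p)) (M *m (x + p)).
Proof.
rewrite [(2 *: p)^T]linearZ /= -scalemxAr -!scalemxAl !scalerA.
have -> : 4^-1 * (2 * 2) = 1 :> R by field.
rewrite scale1r scalemxAl !mxdotpDr !mxdotp_outer !dotp_gram.
rewrite mulmxDr dotpDl !dotpDr -scalemxAr dotpZl.
by rewrite [dotp (M *m x) (M *m p)]dotpC; ring.
Qed.

(** Completing the square turns the quadratic inequality into
    [|L (x + p)|^2 <= |M (x + p)|^2 + gap].  The witness [z] is the norm of the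
    side containing [M], where [gap] stays when it is positive; otherwise [- gap]
    joins the side of [L].  The constraints indexed by [j] follow by scaling with
    the slack. *)
Lemma gsrtB_rank1 n m r s (a : 'I_m -> 'cV[R]_n) (b : 'I_m -> R)
    (Q : 'M[R]_n) (c y : 'cV[R]_n) (d : R)
    (L : 'M[R]_(r, n)) (M : 'M[R]_(s, n)) (x : 'cV[R]_n) :
  Q^T = Q -> Q = L^T *m L - M^T *m M -> c = Q *m y ->
  dotp x (Q *m x) + dotp c x + d <= 0 -> (forall j, dotp (a j) x <= b j) ->
  exists z, gsrtB_cstr a b Q c d L M x (x *m x^T) z (z *: x) (z ^+ 2).
Proof.
move=> sQ hLM hc hq hlin; rewrite /gsrtB_cstr.
set Qd := pseudoinverse Q; set p := 2^-1 *: _; set gap := 4^-1 * _ - d.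
have LM : dotp (L *m (x + p)) (L *m (x + p)) <=
          dotp (M *m (x + p)) (M *m (x + p)) + gap.
  have E : dotp (x + p) (Q *m (x + p)) = _ := complete_square x sQ hc.
  move: E; rewrite {1}hLM mulmxBl dotpBr !dotp_gram -/Qd /gap => E.
  by lra.
have MY : mxdotp (M^T *m M) (x *m x^T + 4^-1 *: (Qd *m c *m c^T *m Qd)
            + Qd *m c *m x^T) = dotp (M *m (x + p)) (M *m (x + p)).
  have -> : Qd *m c = 2 *: p by rewrite /p scalerA divff ?scale1r // pnatr_eq0.
  have -> : 2 *: p *m c^T *m Qd = (2 *: p) *m (2 *: p)^T.
    rewrite -mulmxA /p scalerA divff ?scale1r ?pnatr_eq0 //.
    by rewrite trmx_mul pseudoinverse_sym.
  exact: mxdotp_gram_shift.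
have t0 j : 0 <= b j - dotp (a j) x by rewrite subr_ge0.
have rhs z j : z * b j - dotp (a j) (z *: x) = (b j - dotp (a j) x) * z.
  by rewrite dotpZr; ring.
have [gap_gt0|gap_le0] := ltP 0 gap.
- set De := Num.sqrt gap.
  have De2 : De ^+ 2 = gap by rewrite sqr_sqrtr // ltW.
  pose v := col_mx (M *m (x + p)) (De%:M : 'cV[R]_1).
  have v2 : dotp v v = dotp (M *m (x + p)) (M *m (x + p)) + gap.
    by rewrite dotp_col_mx dotp_scalar -expr2 De2.
  have Lz : enorm (L *m (x + p)) <= enorm v.
    by apply: enorm_le; rewrite ?enorm_ge0 // sqr_enorm v2.
  exists (enorm v); split => // [|j]; first by rewrite sqr_enorm v2 MY De2.
  by rewrite slack_vec rhs col_mx_slack -scalemxAr; split; apply: enormZ_le.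
- have -> : d - 4^-1 * dotp c (Qd *m c) = - gap by rewrite /gap opprB.
  set De := Num.sqrt (- gap).
  have De2 : De ^+ 2 = - gap by rewrite sqr_sqrtr // oppr_ge0.
  pose v := M *m (x + p).
  have Lz : enorm (col_mx (L *m (x + p)) (De%:M : 'cV[R]_1)) <= enorm v.
    apply: enorm_le; rewrite ?enorm_ge0 // sqr_enorm dotp_col_mx dotp_scalar.
    by rewrite -expr2 De2 lerBlDr.
  exists (enorm v); split => // [|j]; first by rewrite sqr_enorm MY.
  by rewrite slack_vec rhs col_mx_slack -scalemxAr; split; apply: enormZ_le.
Qed.

(** Before multiplication by the slack, the cone constraint is the quadratic
    inequality [|B x|^2 <= - t] with [t = c^T x + d], written through the identity
    [- t = ((1 - t) / 2)^2 - ((1 + t) / 2)^2]; it also forces [t <= 0], so the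
    bound [(1 - t) / 2] is nonnegative. *)
Lemma socrlt_rank1 n l m (P : qcqp R n l m) (B : 'I_l -> 'M[R]_n) x :
  (forall i, i \in convex_idx P -> qQ P i = (B i)^T *m B i) ->
  qp_feasible P x -> socrlt_cstr P B x (x *m x^T).
Proof.
move=> hB [hq hlin] i j /hB Qi /=.
set ci := qc P i; set di := qd P i; set aj := qa P j; set bj := qb P j.
have t0 : 0 <= bj - dotp aj x by rewrite subr_ge0; apply: hlin.
pose t := dotp ci x + di.
have Bt : dotp (B i *m x) (B i *m x) <= - t.
  have := hq i; rewrite Qi dotp_gram -/ci -/di /t.
  by lra.
have soc : enorm (col_mx (B i *m x) ((2^-1 * (1 + t))%:M : 'cV[R]_1))
           <= 2^-1 * (1 - t).
  apply: enorm_le; last rewrite dotp_col_mx dotp_scalar.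
    have := dotp_ge0 (B i *m x).
    by lra.
  have -> : (2^-1 * (1 - t)) ^+ 2 = - t + 2^-1 * (1 + t) * (2^-1 * (1 + t)).
    by field.
  by rewrite lerD2r.
have := enormZ_le t0 soc; rewrite -col_mx_slack.
have -> : bj *: x - x *m x^T *m aj = (bj - dotp aj x) *: x.
  by rewrite outer_mul -scalerBl dotpC.
have xXa : dotp ci (x *m x^T *m aj) = dotp aj x * dotp ci x.
  by rewrite outer_mul dotpZr dotpC.
rewrite xXa !(dotpBl, dotpZl) /t.
have -> : 2^-1 * (1 + (dotp ci x + di)) * (bj - dotp aj x) =
  2^-1 * (- (dotp aj x * dotp ci x) +
    (bj * dotp ci x - di * dotp aj x - dotp aj x) + (1 + di) * bj) by ring.
by congr (_ <= _); ring.
Qed.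

Lemma rlt_rank1 n l m (P : qcqp R n l m) x :
  linear_cstr P x -> rlt_cstr P x (x *m x^T).
Proof.
move=> hlin i j _; rewrite mxdotp_outer outer_mul dotpZr [dotp x _]dotpC.
have -> : dotp (qa P j) x * dotp (qa P i) x + qb P i * qb P j
    - qb P j * dotp (qa P i) x - qb P i * dotp (qa P j) x =
  (qb P i - dotp (qa P i) x) * (qb P j - dotp (qa P j) x) by ring.
by apply: mulr_ge0; rewrite subr_ge0; apply: hlin.
Qed.

Lemma gsrt_psd_rank1 n N (x : 'cV[R]_n) (z : 'cV[R]_N) :
  gsrt_psd x (x *m x^T) z (x *m z^T) (z *m z^T).
Proof.
have := psd_outer (col_mx (1%:M : 'cV[R]_1) (col_mx x z)); rewrite /gsrt_psd.
rewrite !tr_col_mx tr_scalar_mx !mul_col_row !mul1mx !mulmx1.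
by rewrite trmx_mul trmxK.
Qed.

End RankOne.

(** * Comparing optimal values *)

Section Compare.
Set Implicit Arguments.
Unset Strict Implicit.
Context {R : realType}.

Lemma gsrt_psd_lifted n N (x : 'cV[R]_n) X (z : 'cV[R]_N) S Z :
  X^T = X -> gsrt_psd x X z S Z -> lifted_psd x X.
Proof.
move=> sX [_ pos]; split=> [|v].
  by rewrite tr_block_mx sX trmxK tr_scalar_mx.
(* Extending the test vector by zero discards the rows and columns of z. *)
have := pos (col_mx (usubmx v) (col_mx (dsubmx v) 0)).
rewrite -[in X in _ -> X](vsubmxK v) !mul_block_col mul_row_col mul_col_mx.
by rewrite !mulmx0 !addr0 add_col_mx !dotp_col_mx [dotp 0 _]dotpC dotp0r addr0.
Qed.

Lemma optval_le {T U} {f : T -> R} {g : U -> R} {F : set T} {G : set U} :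
  (forall y, F y -> exists2 u, G u & g u <= f y) ->
  (optval g G <= optval f F)%E.
Proof.
move=> h; apply: le_ereal_inf_tmp => _ [y /h[u Gu le_gf] <-].
by apply: ge_ereal_inf; exists (g u)%:E; [exists u | rewrite lee_fin].
Qed.

End Compare.

Theorem theorem2p3 (R : realType) (n l m : nat) (P : qcqp R n l m)
    (B V : 'I_l -> 'M[R]_n) (lam : 'I_l -> 'rV[R]_n)
    (hQ0 : (qQ0 P)^T = qQ0 P)
    (hQ : forall i, (qQ P i)^T = qQ P i)
    (hQn0 : forall i, qQ P i <> 0)
    (hB : forall i, i \in convex_idx P -> qQ P i = (B i)^T *m B i)
    (hspec : forall i, i \in nonconvex_idx P -> spectral_decomp (qQ P i) (V i) (lam i))
    (hc : forall i, i \in nonconvex_idx P -> exists y : 'cV[R]_n, qc P i = qQ P i *m y) :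
  [/\ (v_P P >= v_GSRTB P B V lam)%E,
      (v_GSRTB P B V lam >= v_SOCRLT P B)%E,
      (v_SOCRLT P B >= v_RLT P)%E &
      (v_RLT P >= v_SDP P)%E].
Proof.
split; apply: optval_le.
- move=> x [hq hlin].
  have lift_i (k : 'I_#|nonconvex_idx P|) : exists z, let i := enum_val k in
      gsrtB_cstr (qa P) (qb P) (qQ P i) (qc P i) (qd P i)
        (pos_factor (V i) (lam i)) (neg_factor (V i) (lam i))
        x (x *m x^T) z (z *: x) (z ^+ 2).
    have [y hy] := hc _ (enum_valP k).
    exact: gsrtB_rank1 (hQ _) (spectral_split (hspec _ (enum_valP k))) hy _ _.
  have [z hz] := choice lift_i; pose zv := \col_k z k.
  exists (x, x *m x^T, zv, x *m zv^T, zv *m zv^T);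
    last by rewrite /relaxed_obj mxdotp_outer.
  split; split; rewrite ?trmx_mul ?trmxK //.
  + exact: gsrt_psd_rank1.
  + by move=> i; rewrite mxdotp_outer.
  + exact: rlt_rank1.
  + exact: socrlt_rank1.
  + move=> k i.
    have -> : col k (x *m zv^T) = z k *: x.
      by apply/colP => s; rewrite !mxE big_ord1 !mxE mulrC.
    have -> : (zv *m zv^T) k k = z k ^+ 2 by rewrite !mxE big_ord1 !mxE expr2.
    by rewrite mxE; apply: hz.
- move=> [[[[x X] z] S] Z] [[sX _ pX] [hq hlin hr hs _]].
  by exists (x, X) => //; split=> //; split=> //; apply: gsrt_psd_lifted pX.
- by move=> [x X] [sX [hq hlin hp hr _]]; exists (x, X).
- by move=> [x X] [sX [hq hlin hp _]]; exists (x, X).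
Qed.
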